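(* Let $d,n\ge1$ be integers and let $\Omega\subset\mathbb{R}^d$ be a diagonally-determined set with $\mathrm{diag}(\Omega)=[a,b]$, $a<b$, and vector $\mathbf{v}$. Then an optimal signature for the problem $\inf_{P\in\Pi_n^*}\|P\|_\Omega$ is defined by the set $S=\{\omega_1,\dots,\omega_{n+1}\}$ of the $n+1$ points $$\omega_j=a\mathbf{1}+\frac{b-a}{2}\left(1+\cos\left(\frac{(j-1)\pi}{n}\right)\right)\mathbf{1},\qquad j=1,\dots,n+1,$$ together with the function $\sigma:S\to\{-1,1\}$ given by $\sigma(\omega_j)=1$ if $j$ is odd and $\sigma(\omega_j)=-1$ if $j$ is even, and the weights $\lambda_1=\lambda_{n+1}=\frac12$ and $\lambda_i=1$ for $i=2,\dots,n$ (where $\lambda_j$ is the weight attached to $\omega_j$).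
   Context: $\langle\cdot,\cdot\rangle$ is the standard inner product on $\mathbb{R}^d$ and $\mathbf{1}=(1,\dots,1)\in\mathbb{R}^d$. For $\Omega\subset\mathbb{R}^d$, $\mathrm{diag}(\Omega)=\{t\in\mathbb{R}: t\mathbf{1}\in\Omega\}$. The set $\Omega$ is called diagonally-determined, with vector $\mathbf{v}$ and $\mathrm{diag}(\Omega)=[a,b]$, if (1) $\mathrm{diag}(\Omega)$ is an interval $[a,b]$, and (2) $\mathbf{v}\in\mathbb{R}^d$ satisfies $\langle\mathbf{v},\mathbf{1}\rangle=1$ and $\langle\mathbf{v},\mathbf{x}\rangle\in[a,b]$ for all $\mathbf{x}\in\Omega$. No compactness of $\Omega$ is assumed. $\Pi^d_m$ is the space of real polynomials of total degree at most $m$ in $d$ variables. $\mathbb{N}^d_n=\{\alpha\in\mathbb{N}_0^d:|\alpha|=n\}$. $\Pi_n^*$ is the set of polynomials $P(\mathbf{x})=\sum_{\alpha\in\mathbb{N}^d_n}a_\alpha\mathbf{x}^\alpha+Q(\mathbf{x})$ with $\sum_{\alpha\in\mathbb{N}^d_n}a_\alpha=1$ and $Q\in\Pi^d_{n-1}$. $\|P\|_\Omega=\sup_{\mathbf{x}\in\Omega}|P(\mathbf{x})|$. An optimal solution of $\inf_{P\in\Pi_n^*}\|P\|_\Omega$ is a $P^*\in\Pi_n^*$ attaining the infimum. A signature with finite support $S\subset\Omega$ is a function $\sigma:S\to\{\pm1\}$. It is extremal for a subspace $V$ of the space $C(\Omega)$ of continuous functions on $\Omega$ (with weights $\lambda_\omega$)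 if $\lambda_\omega>0$ for all $\omega\in S$ and $\sum_{\omega\in S}\lambda_\omega\sigma(\omega)v(\omega)=0$ for all $v\in V$. It is associated with $g\in C(\Omega)$ if $S\subset\{\omega\in\Omega:|g(\omega)|=\|g\|_\Omega\}$ and $\sigma(\omega)=\mathrm{sgn}(g(\omega))$ for all $\omega\in S$. An optimal signature for the problem $\inf_{P\in\Pi_n^*}\|P\|_\Omega$ is a signature that is extremal for $\Pi^d_{n-1}$ (with the stated weights) and associated with every optimal solution of this problem. *)

(* Defs.v *)
From HB Require Import structures.
From mathcomp Require Import all_boot all_order all_algebra finmap.
From mathcomp Require Import all_classical all_reals all_analysis.
(* The notations of [mpoly] clash with those of analysis. *)
From mathcomp Require Import (coercions, canonicals) mpoly.

Set Implicit Arguments.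
Unset Strict Implicit.
Unset Printing Implicit Defensive.

Import Order.TTheory GRing.Theory Num.Theory.

Local Open Scope classical_set_scope.
Local Open Scope ring_scope.

Definition inner (R : realType) (d : nat) (u x : 'rV[R]_d) : R :=
  \sum_(i < d) u 0 i * x 0 i.

Definition ones (R : realType) (d : nat) : 'rV[R]_d := const_mx 1.

Definition diag (R : realType) (d : nat) (Omega : set 'rV[R]_d) : set R :=
  [set t | Omega (t *: ones R d)].

Definition diagonally_determined (R : realType) (d : nat)
    (Omega : set 'rV[R]_d) (v : 'rV[R]_d) (a b : R) : Prop :=
  [/\ diag Omega = `[a, b]%classic,
      inner v (ones R d) = 1
    & forall x, Omega x -> `[a, b]%classic (inner v x)].

(* [mpoly.msize] is the total degree plus one, and 0 for the zero polynomial. *)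
Definition Pi (R : realType) (d m : nat) : set (mpoly.mpoly d R) :=
  [set P | (mpoly.msize P <= m.+1)%N].

(* [mpoly.bmultinom d n.+1] is the finite type of exponents of total degree
   less than [n.+1]; the filter keeps those of degree exactly [n]. *)
Definition Pi_star (R : realType) (d n : nat) : set (mpoly.mpoly d R) :=
  [set P : mpoly.mpoly d R | exists (c : mpoly.multinom d -> R) (Q : mpoly.mpoly d R),
    [/\ \sum_(alpha : mpoly.bmultinom d n.+1 | mpoly.mdeg alpha == n)
          c alpha = 1,
        Pi n.-1 Q
      & P = \sum_(alpha : mpoly.bmultinom d n.+1 | mpoly.mdeg alpha == n)
              c alpha *: mpoly.mpolyX R alpha + Q]].

Definition polyfun (R : realType) (d : nat) (P : mpoly.mpoly d R)
    (x : 'rV[R]_d) : R :=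
  mpoly.meval (fun i => x 0 i) P.

(* Extended-real valued, since a polynomial may be unbounded on [Omega]. *)
Definition supnorm (R : realType) (d : nat) (Omega : set 'rV[R]_d)
    (g : 'rV[R]_d -> R) : \bar R :=
  ereal_sup [set (`|g x|)%:E | x in Omega].

Definition optimal_solution (R : realType) (d : nat) (Omega : set 'rV[R]_d)
    (n : nat) (P : mpoly.mpoly d R) : Prop :=
  Pi_star n P /\
  supnorm Omega (polyfun P) =
    ereal_inf [set supnorm Omega (polyfun Q) | Q in @Pi_star R d n].

(* A function on the finite support [S] (a sign or a weight) is represented by a
   function on the whole space of which only the values on [S] are used. *)
Definition signature (R : realType) (d : nat) (Omega : set 'rV[R]_d)
    (S : {fset 'rV[R]_d}) (sigma : 'rV[R]_d -> R) : Prop :=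
  forall w, w \in S -> Omega w /\ (sigma w = 1 \/ sigma w = -1).

Definition extremal (R : realType) (d : nat) (V : set ('rV[R]_d -> R))
    (S : {fset 'rV[R]_d}) (sigma lambda : 'rV[R]_d -> R) : Prop :=
  (forall w, w \in S -> 0 < lambda w) /\
  (forall f, V f -> \sum_(w <- S) lambda w * sigma w * f w = 0).

Definition associated (R : realType) (d : nat) (Omega : set 'rV[R]_d)
    (S : {fset 'rV[R]_d}) (sigma g : 'rV[R]_d -> R) : Prop :=
  forall w, w \in S ->
    [/\ Omega w, (`|g w|)%:E = supnorm Omega g & sigma w = Num.sg (g w)].

Definition optimal_signature (R : realType) (d : nat) (Omega : set 'rV[R]_d)
    (n : nat) (S : {fset 'rV[R]_d}) (sigma lambda : 'rV[R]_d -> R) : Prop :=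
  [/\ signature Omega S sigma,
      extremal [set polyfun P | P in @Pi R d n.-1] S sigma lambda
    & forall P, optimal_solution Omega n P ->
        associated Omega S sigma (polyfun P)].

Definition omega (R : realType) (d n : nat) (a b : R) (j : nat) : 'rV[R]_d :=
  a *: ones R d
  + ((b - a) / 2 * (1 + cos ((j%:R - 1) * pi / n%:R))) *: ones R d.

(* Main.v *)
Require Import Defs.
From HB Require Import structures.
From mathcomp Require Import all_boot all_order all_algebra finmap.
From mathcomp Require Import all_classical all_reals all_analysis.
From mathcomp Require Import (coercions, canonicals) mpoly.
From mathcomp Require Import ring lra zify.

Set Implicit Arguments.
Unset Strict Implicit.
Unset Printing Implicit Defensive.

Import Order.TTheory GRing.Theory Num.Theory.

Local Open Scope classical_set_scope.
Local Open Scope ring_scope.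

(** The problem is reduced to the classical monic Chebyshev problem on [a, b]
    by restricting polynomials to the diagonal and, conversely, by composing
    univariate polynomials with the linear form x |-> <v, x>.

    Restricting a polynomial of Pi_star to the points t 1 gives a monic
    univariate polynomial of degree n, because the top coefficients sum to 1
    ([size_diag_poly_subXn]). In the other direction, <v, 1> = 1 makes q(<v, x>)
    an element of Pi_star for each monic q of degree n ([ridge_Pi_star]), and
    <v, x> stays in [a, b] on Omega. With the monic Chebyshev polynomial for q,
    this bounds the optimal value by E = 2 ((b - a) / 4)^n
    ([supnorm_optimal_le]).

    The signature acts on univariate polynomials as the alternating trapezoidal
    sum over the Chebyshev extrema, which annihilates every polynomial of degree
    less than n ([trapezoid_poly]). This is extremality. It also shows that
    every optimal solution takes the values +E and -E in turn at the points
    omega_j ([monic_equioscillation]): the diagonal restriction p of such a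
    solution is bounded by E at the nodes, the sum annihilates q - p, and all the
    terms of that sum are nonnegative, so each of them vanishes. Thus E is at
    most the norm of the solution, hence equal to it, and the solution has the
    prescribed signs. *)

(** * The alternating trapezoidal sum at the Chebyshev extrema *)

(** The affine image in [a, b] of the point cos theta of [-1, 1]; the Chebyshev
    extrema are the nodes at the angles k pi / n. *)
Definition node (R : realType) (a b theta : R) : R :=
  a + (b - a) / 2 * (1 + cos theta).

(** Indices start at 0, so that index [k] carries the sign and the weight that
    the signature gives to [omega_(k+1)]. *)
Definition trapezoid (R : realType) (n : nat) (f : nat -> R) : R :=
  \sum_(k < n.+1) (if (k == 0%N :> nat) || (k == n :> nat) then 1 / 2 else 1)
    * (-1) ^+ k * f k.

(** Halving the end weights makes the sum an average over consecutive pairs,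
    the form in which it telescopes on cosines. *)
Lemma trapezoid_pairs (R : realType) (n : nat) (f : nat -> R) : (0 < n)%N ->
  trapezoid n f = 1 / 2 * \sum_(k < n) (-1) ^+ k * (f k - f k.+1).
Proof.
case: n => // n _; rewrite /trapezoid big_ord_recl big_ord_recr /= eqxx /=.
rewrite (eq_bigr (fun k : 'I_n => (-1) ^+ k.+1 * f k.+1)); last first.
  by move=> k _; rewrite /bump /= add1n eqSS (ltn_eqF (ltn_ord k)) mul1r.
rewrite /bump /= add1n.
rewrite (eq_bigr (fun k : 'I_n.+1 => (-1) ^+ k * f k + (-1) ^+ k.+1 * f k.+1));
  last by move=> k _; rewrite exprS; ring.
rewrite big_split /= big_ord_recl [X in _ = _ * (_ + X)]big_ord_recr /=.
by rewrite (eq_bigr (fun k : 'I_n => (-1) ^+ k.+1 * f k.+1)) //; lra.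
Qed.

Lemma cosM2cos (R : realType) (x y : R) :
  2 * (cos x * cos y) = cos (x + y) + cos (x - y).
Proof. rewrite cosD cosB; ring. Qed.

(** With phi = l pi / n, multiplication by cos (phi / 2) makes the paired sum
    telescope to a multiple of sin (n phi) = sin (l pi) = 0, and cos (phi / 2) is
    nonzero because l < n puts phi / 2 below pi / 2. *)
Lemma trapezoid_cos (R : realType) (n l : nat) : (l < n)%N ->
  trapezoid n (fun k => cos (l%:R * (k%:R * pi / n%:R : R))) = 0.
Proof.
move=> ltln; have n0 : (0 < n)%N by apply: leq_ltn_trans ltln.
have nR0 : (0 : R) < n%:R by rewrite ltr0n.
rewrite trapezoid_pairs //.
pose phi : R := l%:R * pi / n%:R.
pose h := phi / 2.
have phiE : phi = h + h by rewrite /h; field.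
have cos_neq0 : cos h != 0.
  rewrite gt_eqF// cos_gt0_pihalf//; apply/andP; split.
    rewrite /h /phi; apply: (@lt_le_trans _ _ 0).
      by rewrite oppr_lt0 divr_gt0 // pi_gt0.
    by rewrite !mulr_ge0 ?invr_ge0 ?pi_ge0 // ltW.
  rewrite /h ltr_pM2r ?invr_gt0 // /phi ltr_pdivrMr // mulrC.
  by rewrite ltr_pM2l ?pi_gt0 // ltr_nat.
have step (k : nat) : cos h * ((-1) ^+ k * (cos (l%:R * (k%:R * pi / n%:R))
      - cos (l%:R * (k.+1%:R * pi / n%:R))))
    = sin h * ((-1) ^+ k * sin (k%:R * phi)
               - (-1) ^+ k.+1 * sin (k.+1%:R * phi)).
  have -> : l%:R * (k%:R * pi / n%:R) = k%:R * phi by rewrite /phi; ring.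
  have -> : l%:R * (k.+1%:R * pi / n%:R) = k.+1%:R * phi by rewrite /phi; ring.
  have -> : k.+1%:R * phi = (k%:R * phi + h) + h.
    by rewrite -natr1 mulrDl mul1r {2}phiE addrA.
  have -> : k%:R * phi = (k%:R * phi + h) - h by rewrite addrK.
  move: (k%:R * phi + h) => u; rewrite subrK exprS cosB sinB cosD sinD; ring.
have -> : \sum_(k < n) (-1) ^+ k * (cos (l%:R * (k%:R * pi / n%:R : R))
      - cos (l%:R * (k.+1%:R * pi / n%:R : R))) = 0; last by rewrite mulr0.
apply: (mulfI cos_neq0); rewrite mulr0 mulr_sumr.
rewrite (eq_bigr _ (fun (k : 'I_n) _ => step k)) -mulr_sumr.
pose s (k : nat) : R := - ((-1) ^+ k * sin (k%:R * phi)).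
rewrite (eq_bigr (fun k : 'I_n => s k.+1 - s k)); last first.
  by move=> k _; rewrite /s opprK addrC.
rewrite -(big_mkord xpredT (fun k => s k.+1 - s k)) telescope_sumr //.
rewrite /s mul0r sin0 mulr0.
have -> : n%:R * phi = 0 + pi *+ l.
  by rewrite add0r /phi mulrC divfK ?gt_eqF // mulr_natl.
suff -> : sin (0 + pi *+ l) = 0 :> R by rewrite mulr0 subrr mulr0.
by rewrite alternatingn ?sin0 ?mulr0 //; exact: sinDpi.
Qed.

Lemma trapezoidZ (R : realType) (n : nat) (c : R) (f : nat -> R) :
  trapezoid n (fun k => c * f k) = c * trapezoid n f.
Proof. by rewrite /trapezoid mulr_sumr; apply: eq_bigr => k _; ring. Qed.

Lemma trapezoidD (R : realType) (n : nat) (f g : nat -> R) :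
  trapezoid n (fun k => f k + g k) = trapezoid n f + trapezoid n g.
Proof. by rewrite /trapezoid -big_split; apply: eq_bigr => k _ /=; ring. Qed.

Lemma eq_trapezoid (R : realType) (n : nat) (f g : nat -> R) :
  f =1 g -> trapezoid n f = trapezoid n g.
Proof. by move=> fg; apply: eq_bigr => k _; rewrite fg. Qed.

(** Multiplying cos (l theta) by the node of angle theta changes the frequency l
    by at most 1, so the induction on m trades a power of the node for a
    frequency, and m + l < n keeps all the frequencies below n. *)
Lemma trapezoid_expr_cos (R : realType) (a b : R) (n m l : nat) :
  (m + l < n)%N ->
  trapezoid n (fun k => node a b (k%:R * pi / n%:R) ^+ m
                        * cos (l%:R * (k%:R * pi / n%:R))) = 0.
Proof.
elim: m l => [|m IH] l lt_n.
  rewrite -[RHS](@trapezoid_cos R n l) //; apply: eq_trapezoid => k.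
  by rewrite expr0 mul1r.
(* The frequency l - 1 is not a natural number when l = 0. *)
case: l lt_n => [|l] lt_n.
  rewrite (@eq_trapezoid _ _ _ (fun k =>
    (a + (b - a) / 2) * (node a b (k%:R * pi / n%:R) ^+ m
                          * cos (0%:R * (k%:R * pi / n%:R)))
    + (b - a) / 2 * (node a b (k%:R * pi / n%:R) ^+ m
                          * cos (1%:R * (k%:R * pi / n%:R))))).
    by rewrite trapezoidD !trapezoidZ !IH ?mulr0 ?addr0 //; lia.
  move=> k; rewrite mul0r cos0 mul1r exprS.
  by move: (_ ^+ m) => z; rewrite /node; ring.
rewrite (@eq_trapezoid _ _ _ (fun k =>
    (a + (b - a) / 2) * (node a b (k%:R * pi / n%:R) ^+ m
                          * cos (l.+1%:R * (k%:R * pi / n%:R)))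
    + ((b - a) / 4 * (node a b (k%:R * pi / n%:R) ^+ m
                          * cos (l.+2%:R * (k%:R * pi / n%:R)))
    + (b - a) / 4 * (node a b (k%:R * pi / n%:R) ^+ m
                          * cos (l%:R * (k%:R * pi / n%:R)))))).
  by rewrite !trapezoidD !trapezoidZ !IH ?mulr0 ?addr0 //; lia.
move=> k; move: (k%:R * pi / n%:R) => x.
have -> : l.+2%:R * x = l.+1%:R * x + x by rewrite -[l.+2]addn1 natrD; ring.
have -> : l%:R * x = l.+1%:R * x - x by rewrite -[l.+1]addn1 natrD; ring.
have := cosM2cos (l.+1%:R * x) x; rewrite exprS.
move: (_ ^+ m) (cos (_ + _)) (cos (_ - _)) => z u w uw.
have -> : u = 2 * (cos (l.+1%:R * x) * cos x) - w by rewrite uw addrK.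
by rewrite /node; field.
Qed.

Lemma trapezoid_sum (R : realType) (n m : nat) (f : 'I_m -> nat -> R) :
  trapezoid n (fun k => \sum_(i < m) f i k) = \sum_(i < m) trapezoid n (f i).
Proof.
rewrite /trapezoid exchange_big /=; apply: eq_bigr => k _.
by rewrite mulr_sumr.
Qed.

Lemma trapezoid_poly (R : realType) (a b : R) (n : nat) (p : {poly R}) :
  (size p <= n)%N ->
  trapezoid n (fun k => p.[node a b (k%:R * pi / n%:R)]) = 0.
Proof.
move=> sp.
rewrite (@eq_trapezoid _ _ _ (fun k => \sum_(i < size p) p`_i *
  (node a b (k%:R * pi / n%:R) ^+ i * cos (0%:R * (k%:R * pi / n%:R))))).
  rewrite trapezoid_sum big1 // => i _.
  by rewrite trapezoidZ trapezoid_expr_cos ?mulr0 // addn0 (leq_trans _ sp).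
by move=> k; rewrite horner_coef; apply: eq_bigr => i _; rewrite mul0r cos0 mulr1.
Qed.

(** * The monic Chebyshev polynomial of an interval *)

(** The Chebyshev recurrence rescaled to [a, b] so as to preserve monicity. The
    initial value 2, and not 1, gives all degrees the one formula of
    [monic_cheb_node]; the polynomial is monic only from degree 1 on. *)
Fixpoint monic_cheb (R : realType) (a b : R) (n : nat) : {poly R} :=
  match n with
  | 0%N => 2%:P
  | 1%N => 'X - ((a + b) / 2)%:P
  | (k.+1 as m).+1 => ('X - ((a + b) / 2)%:P) * monic_cheb a b m
                      - ((b - a) / 4) ^+ 2 *: monic_cheb a b k
  end.

Lemma nat_ind2 (P : nat -> Prop) :
  P 0%N -> P 1%N -> (forall n, P n -> P n.+1 -> P n.+2) -> forall n, P n.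
Proof.
move=> P0 P1 PS n; suff [] : P n /\ P n.+1 by [].
by elim: n => [|n [Pn PSn]]; split=> //; apply: PS.
Qed.

Lemma monic_cheb_node (R : realType) (a b : R) (n : nat) (theta : R) :
  (monic_cheb a b n).[node a b theta]
    = 2 * ((b - a) / 4) ^+ n * cos (n%:R * theta).
Proof.
elim/nat_ind2: n => [||n IH0 IH1].
- by rewrite /= hornerC expr0 mul0r cos0 !mulr1.
- by rewrite hornerXsubC expr1 mul1r /node; field.
rewrite [monic_cheb _ _ _]/= -/(monic_cheb a b n.+1).
rewrite hornerD hornerN hornerM hornerZ IH0 IH1 hornerXsubC.
have -> : n.+2%:R * theta = n.+1%:R * theta + theta.
  by rewrite -[n.+2]addn1 natrD; ring.
have e : n%:R * theta = n.+1%:R * theta - theta.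
  by rewrite -[n.+1]addn1 natrD; ring.
have := cosM2cos (n.+1%:R * theta) theta; rewrite -e !exprS.
move: (_ ^+ n) (cos (n%:R * _)) (cos (_ + _)) => z u w uw.
have -> : w = 2 * (cos (n.+1%:R * theta) * cos theta) - u by rewrite uw addrK.
by rewrite /node; field.
Qed.

Lemma size_monic_cheb (R : realType) (a b : R) (n : nat) :
  (size (monic_cheb a b n) <= n.+1)%N.
Proof.
elim/nat_ind2: n => [||n IH0 IH1].
- by rewrite size_polyC; case: eqP.
- by rewrite size_XsubC.
rewrite [monic_cheb _ _ _]/= -/(monic_cheb a b n.+1).
rewrite (leq_trans (size_polyD _ _)) // geq_max size_polyN; apply/andP; split.
  by rewrite (leq_trans (size_polyMleq _ _)) // size_XsubC.
by rewrite (leq_trans (size_scale_leq _ _)) // (leq_trans IH0) // ltnW.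
Qed.

(** Monic of degree n, in the form used for all polynomials below: subtracting
    the power leaves a polynomial of degree less than n. *)
Lemma size_monic_cheb_subXn (R : realType) (a b : R) (n : nat) : (0 < n)%N ->
  (size (monic_cheb a b n - 'X^n)%R <= n)%N.
Proof.
case: n => // n _; elim: n => [|n IH].
  by rewrite /= expr1 addrAC subrr sub0r size_polyN size_polyC leq_b1.
rewrite [monic_cheb _ _ _]/= -/(monic_cheb a b n.+1).
have -> : ('X - ((a + b) / 2)%:P) * monic_cheb a b n.+1
    - ((b - a) / 4) ^+ 2 *: monic_cheb a b n - 'X^(n.+2)
  = 'X * (monic_cheb a b n.+1 - 'X^(n.+1))
    + (- ((a + b) / 2) *: monic_cheb a b n.+1
       + - ((b - a) / 4) ^+ 2 *: monic_cheb a b n) :> {poly R}.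
  rewrite -!mul_polyC !polyCN ['X^(n.+2)]exprS.
  move: (monic_cheb a b n.+1) (monic_cheb a b n) ('X^(n.+1)) (_ %:P) (_ %:P)
    => p q x u w; ring.
rewrite (leq_trans (size_polyD _ _)) // geq_max; apply/andP; split.
  by rewrite (leq_trans (size_polyMleq _ _)) // size_polyX.
rewrite (leq_trans (size_polyD _ _)) // geq_max; apply/andP; split.
  by rewrite (leq_trans (size_scale_leq _ _)) // size_monic_cheb.
rewrite (leq_trans (size_scale_leq _ _)) //.
by rewrite (leq_trans (size_monic_cheb _ _ _)).
Qed.

Lemma nodeP (R : realType) (a b t : R) : a < b -> a <= t <= b ->
  exists theta, t = node a b theta.
Proof.
move=> ab /andP[at_ tb]; pose x := (t - (a + b) / 2) / ((b - a) / 2).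
have h0 : 0 < (b - a) / 2 by lra.
exists (acos x); rewrite /node acosK; last first.
  rewrite in_itv /= /x ler_pdivlMr // ler_pdivrMr //; apply/andP; split; lra.
have -> : (b - a) / 2 * (1 + x) = (b - a) / 2 + (t - (a + b) / 2).
  by rewrite /x mulrDr mulr1 [_ * (_ / _)]mulrC divfK // gt_eqF.
lra.
Qed.

Lemma node_itv (R : realType) (a b theta : R) : a < b ->
  a <= node a b theta <= b.
Proof.
move=> ab; have := cos_le1 theta; have := cos_geN1 theta; rewrite /node.
move=> ? ?; apply/andP; split; nra.
Qed.

Lemma monic_cheb_le (R : realType) (a b t : R) (n : nat) :
  a < b -> a <= t <= b -> `|(monic_cheb a b n).[t]| <= 2 * ((b - a) / 4) ^+ n.
Proof.
move=> ab /(nodeP ab)[theta ->]; rewrite monic_cheb_node normrM.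
have E0 : 0 <= 2 * ((b - a) / 4) ^+ n.
  by rewrite mulr_ge0 // exprn_ge0 //; lra.
by rewrite (ger0_norm E0) ler_piMr // ler_norml cos_geN1 cos_le1.
Qed.

Lemma cos_natmul_pi (R : realType) (k : nat) : cos (k%:R * pi) = (-1) ^+ k :> R.
Proof.
rewrite mulr_natl -[_ *+ _]add0r alternatingn ?cos0 ?mulr1 //; exact: cosDpi.
Qed.

Lemma monic_cheb_extremum (R : realType) (a b : R) (n k : nat) : (0 < n)%N ->
  (monic_cheb a b n).[node a b (k%:R * pi / n%:R)]
    = (-1) ^+ k * (2 * ((b - a) / 4) ^+ n).
Proof.
move=> n0; rewrite monic_cheb_node mulrCA divff ?pnatr_eq0 -?lt0n // mulr1.
by rewrite cos_natmul_pi mulrC.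
Qed.

(** * Restriction to the diagonal *)

Definition diag_poly (R : realType) (d : nat) (P : mpoly.mpoly d R) : {poly R} :=
  mpoly.mmap (@polyC R) (fun=> 'X) P.

Lemma horner_diag_poly (R : realType) (d : nat) (P : mpoly.mpoly d R) (t : R) :
  (diag_poly P).[t] = polyfun P (t *: ones R d).
Proof.
rewrite /diag_poly /polyfun mpoly.mevalE /mpoly.mmap horner_sum.
apply: eq_bigr => m _; rewrite hornerM hornerC /mpoly.mmap1 horner_prod.
by congr (_ * _); apply: eq_bigr => i _; rewrite hornerXn !mxE mulr1.
Qed.

Lemma mmap1_diag (R : realType) (d : nat) (m : mpoly.multinom d) :
  mpoly.mmap1 (fun=> 'X) m = 'X^(mpoly.mdeg m) :> {poly R}.
Proof. by rewrite /mpoly.mmap1 prodrXr mpoly.mdegE. Qed.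

Lemma size_diag_poly (R : realType) (d : nat) (P : mpoly.mpoly d R) :
  (size (diag_poly P) <= mpoly.msize P)%N.
Proof.
rewrite /diag_poly (mpoly.mmapE _ (leqnn _)).
apply: (leq_trans (size_sum _ _ _)); apply/bigmax_leqP => m _.
rewrite mmap1_diag mul_polyC (leq_trans (size_scale_leq _ _)) // size_polyXn.
exact: mpoly.bmdeg.
Qed.

(** On the diagonal all the monomials of degree n become the same power of t, so
    the coefficient of t^n is the sum of the top coefficients, which is 1. *)
Lemma size_diag_poly_subXn (R : realType) (d n : nat) (P : mpoly.mpoly d R) :
  (0 < n)%N -> Pi_star n P -> (size (diag_poly P - 'X^n)%R <= n)%N.
Proof.
move=> n0 [c [Q [c1 sQ ->]]].
have -> : diag_poly (\sum_(alpha : mpoly.bmultinom d n.+1 | mpoly.mdeg alpha == n)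
    c alpha *: mpoly.mpolyX R alpha + Q) = 'X^n + diag_poly Q.
  rewrite /diag_poly mpoly.mmapD raddf_sum /=; congr (_ + _).
  rewrite (eq_bigr (fun alpha : mpoly.bmultinom d n.+1 => c alpha *: 'X^n)).
    by rewrite -scaler_suml c1 scale1r.
  move=> m /eqP mn; rewrite mpoly.mmapZ mpoly.mmapX mmap1_diag mn.
  by rewrite mul_polyC.
rewrite addrAC subrr add0r (leq_trans (size_diag_poly _)) //.
by move: sQ; rewrite /Pi /= prednK.
Qed.

(** * Composition with a linear form *)

Lemma msize_homog (R : realType) (d k : nat) (P : mpoly.mpoly d R) :
  P \is mpoly.ishomog1 k mpoly.mdeg -> (mpoly.msize P <= k.+1)%N.
Proof.
move=> /mpoly.dhomogP Pk; rewrite mpoly.msizeE.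
by apply/bigmax_leqP_seq => m mP _; rewrite Pk.
Qed.

(** Writing ell for the linear form of v, the part of degree n is ell^n; its
    coefficients sum to its value at the all-ones point, <v, 1>^n = 1. *)
Lemma ridge_Pi_star (R : realType) (d n : nat) (v : 'rV[R]_d) (q : {poly R}) :
  (0 < n)%N -> inner v (ones R d) = 1 -> (size (q - 'X^n)%R <= n)%N ->
  exists2 P, Pi_star n P & forall x, polyfun P x = q.[inner v x].
Proof.
move=> n0 v1 sq.
pose ell : mpoly.mpoly d R := \sum_(i < d) v 0 i *: mpoly.mpolyX R (mpoly.mnm1 i).
have ellE x : polyfun ell x = inner v x.
  rewrite /polyfun /ell raddf_sum; apply: eq_bigr => i _.
  by rewrite /= mpoly.mevalZ mpoly.mevalXU.
have hom k : ell ^+ k \is mpoly.ishomog1 k mpoly.mdeg.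
  rewrite -{2}[k]mul1n; apply: mpoly.dhomogMn; apply: rpred_sum => i _.
  by apply: rpredZ; rewrite mpoly.dhomogX /= mpoly.mdeg1.
have qn : q`_n = 1.
  have := nth_default 0 sq; rewrite coefB coefXn eqxx => /eqP.
  by rewrite subr_eq0 => /eqP.
have sizeq : (size q <= n.+1)%N.
  rewrite -[q](subrK 'X^n) (leq_trans (size_polyD _ _)) // geq_max size_polyXn.
  by rewrite leqnn andbT ltnW.
exists (\sum_(k < n.+1) q`_k *: ell ^+ k); last first.
  move=> x; rewrite /polyfun raddf_sum /= (horner_coef_wide _ sizeq).
  by apply: eq_bigr => k _; rewrite mpoly.mevalZ rmorphXn /= -ellE.
rewrite big_ord_recr /= qn scale1r addrC.
exists (fun m => mpoly.mcoeff m (ell ^+ n)), (\sum_(k < n) q`_k *: ell ^+ k).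
have ellX : ell ^+ n = \sum_(alpha : mpoly.bmultinom d n.+1 | mpoly.mdeg alpha == n)
      mpoly.mcoeff alpha (ell ^+ n) *: mpoly.mpolyX R alpha.
  rewrite [LHS](mpoly.mpolywE (msize_homog (hom n))).
  rewrite [RHS]big_mkcond /=; apply: eq_bigr => m _; case: ifPn => // mn.
  by rewrite (mpoly.dhomog_nemf_coeff (hom n)) // scale0r.
split; last by rewrite -ellX.
- have := congr1 (fun P => polyfun P (ones R d)) ellX.
  rewrite /= {1}/polyfun rmorphXn /= -/(polyfun _ _) ellE v1 expr1n => ->.
  rewrite /polyfun raddf_sum; apply: eq_bigr => m _ /=.
  rewrite mpoly.mevalZ mpoly.mevalX big1 ?mulr1 // => i _.
  by rewrite mxE expr1n.
rewrite /Pi /= prednK //; apply: (leq_trans (mpoly.mmeasure_sum _ _ _ _)).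
apply/bigmax_leqP => k _; apply: (leq_trans (mpoly.msizeZ_le _ _)).
exact: leq_trans (msize_homog (hom k)) (ltn_ord k).
Qed.

(** * Rigidity of the Chebyshev nodes *)

(** With E = 2 ((b - a) / 4)^n, at the node of index k the term of the
    alternating sum for the difference of the Chebyshev polynomial and p is, up
    to its positive weight, E - (-1)^k p >= 0. Both polynomials are monic of
    degree n, so the sum is zero and every term vanishes. *)
Lemma monic_equioscillation (R : realType) (a b : R) (n : nat) (p : {poly R}) :
  (0 < n)%N -> (size (p - 'X^n)%R <= n)%N ->
  (forall k, (k <= n)%N ->
     `|p.[node a b (k%:R * pi / n%:R)]| <= 2 * ((b - a) / 4) ^+ n) ->
  forall k, (k <= n)%N ->
    p.[node a b (k%:R * pi / n%:R)] = (-1) ^+ k * (2 * ((b - a) / 4) ^+ n).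
Proof.
move=> n0 sp pE; set E := 2 * _ in pE *.
have size_diff : (size (monic_cheb a b n - p)%R <= n)%N.
  have -> : monic_cheb a b n - p = (monic_cheb a b n - 'X^n) - (p - 'X^n).
    by rewrite opprB addrA subrK.
  by rewrite (leq_trans (size_polyD _ _)) // geq_max size_polyN sp
    size_monic_cheb_subXn.
have gap (k : nat) : (-1) ^+ k * (monic_cheb a b n - p).[node a b (k%:R * pi / n%:R)]
    = E - (-1) ^+ k * p.[node a b (k%:R * pi / n%:R)].
  by rewrite hornerD hornerN monic_cheb_extremum // mulrBr mulrA -signr_odd
    -expr2 sqrr_sign mul1r.
have gap_ge0 k : (k <= n)%N -> 0 <= E - (-1) ^+ k * p.[node a b (k%:R * pi / n%:R)].
  move=> kn; rewrite subr_ge0 (le_trans (ler_norm _)) //.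
  by rewrite normrMsign pE.
have := trapezoid_poly a b size_diff; rewrite /trapezoid => sum0 k kn.
have wgt0 (c : bool) : 0 < (if c then 1 / 2 else 1) :> R by case: c; lra.
have term_ge0 (i : 'I_n.+1) : true ->
    0 <= (if (i == 0%N :> nat) || (i == n :> nat) then 1 / 2 else 1)
         * (-1) ^+ i * (monic_cheb a b n - p).[node a b (i%:R * pi / n%:R)].
  by move=> _; rewrite -mulrA gap mulr_ge0 ?gap_ge0 ?(ltW (wgt0 _)) // -ltnS.
have /eqP := psumr_eq0P term_ge0 sum0 (i := Ordinal (kn : (k < n.+1)%N)) isT.
rewrite /= -mulrA gap mulf_eq0 (gt_eqF (wgt0 _)) /= subr_eq0 => /eqP ->.
by rewrite signrMK.
Qed.

(** * The signature *)

Lemma omega_node (R : realType) (d n : nat) (a b : R) (k : nat) :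
  omega d n a b k.+1 = node a b (k%:R * pi / n%:R) *: ones R d.
Proof. by rewrite /omega -scalerDl -[k.+1%:R]natr1 addrK. Qed.

Lemma omega_inj (R : realType) (d n : nat) (a b : R) (k l : nat) :
  (0 < d)%N -> (0 < n)%N -> a < b -> (k <= n)%N -> (l <= n)%N ->
  omega d n a b k.+1 = omega d n a b l.+1 -> k = l.
Proof.
move=> d0 n0 ab kn ln; rewrite !omega_node => /rowP/(_ (Ordinal d0)).
rewrite !mxE !mulr1 /node => /addrI/mulfI h.
have {}h : cos (k%:R * pi / n%:R) = cos (l%:R * pi / n%:R) :> R.
  by apply: (@addrI _ 1); apply: h; lra.
have nR0 : (0 : R) < n%:R by rewrite ltr0n.
have pi0 := pi_gt0 R.
have angle (i : nat) : (i <= n)%N -> i%:R * pi / n%:R \in `[0, pi : R].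
  move=> lein; rewrite in_itv /= !mulr_ge0 ?invr_ge0 ?(ltW pi0) //=.
  by rewrite ler_pdivrMr // mulrC ler_pM2l // ler_nat.
have := cos_inj (angle k kn) (angle l ln) h.
move=> /(divIf (lt0r_neq0 nR0))/(mulIf (lt0r_neq0 pi0))/eqP.
by rewrite eqr_nat => /eqP.
Qed.

Lemma polyfun_omega (R : realType) (d n : nat) (a b : R)
    (P : mpoly.mpoly d R) (k : nat) :
  polyfun P (omega d n a b k.+1) = (diag_poly P).[node a b (k%:R * pi / n%:R)].
Proof. by rewrite omega_node horner_diag_poly. Qed.

Lemma le_supnorm (R : realType) (d : nat) (Omega : set 'rV[R]_d)
    (g : 'rV[R]_d -> R) (x : 'rV[R]_d) :
  Omega x -> (`|g x|%:E <= supnorm Omega g)%E.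
Proof. by move=> Ox; apply: ereal_sup_ubound; exists x. Qed.

(** The competitor is the monic Chebyshev polynomial of [a, b] evaluated at
    <v, x>; since <v, x> lies in [a, b], its bound holds on all of Omega, even
    when Omega is unbounded. *)
Lemma supnorm_optimal_le (R : realType) (d n : nat) (Omega : set 'rV[R]_d)
    (v : 'rV[R]_d) (a b : R) (P : mpoly.mpoly d R) :
  (0 < n)%N -> a < b -> diagonally_determined Omega v a b ->
  optimal_solution Omega n P ->
  (supnorm Omega (polyfun P) <= (2 * ((b - a) / 4) ^+ n)%:E)%E.
Proof.
move=> n0 ab [_ v1 Omegav] [_ ->].
have [P0 P0star P0E] := ridge_Pi_star n0 v1 (size_monic_cheb_subXn a b n0).
apply: ge_ereal_inf; exists (supnorm Omega (polyfun P0)); first by exists P0.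
apply: ge_ereal_sup => _ [x Ox <-]; rewrite lee_fin P0E monic_cheb_le //.
by have := Omegav x Ox; rewrite /= in_itv.
Qed.

Theorem theorem4p8 (R : realType) (d n : nat) (hd : (1 <= d)%N) (hn : (1 <= n)%N)
    (Omega : set 'rV[R]_d) (v : 'rV[R]_d) (a b : R) (hab : a < b)
    (hOmega : diagonally_determined Omega v a b)
    (S : {fset 'rV[R]_d})
    (hS : S = [fset omega d n a b j | j in iota 1 n.+1]%fset) :
  #|` S| = n.+1 /\
  forall sigma lambda : 'rV[R]_d -> R,
    (forall j : nat, (1 <= j <= n.+1)%N ->
       sigma (omega d n a b j) = if odd j then 1 else -1) ->
    (forall j : nat, (1 <= j <= n.+1)%N ->
       lambda (omega d n a b j) = if (j == 1%N) || (j == n.+1) then 1 / 2 else 1) ->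
    optimal_signature Omega n S sigma lambda.
Proof.
pose pts := [seq omega d n a b k.+1 | k <- iota 0 n.+1].
have memS w : (w \in S) = (w \in pts).
  rewrite hS; apply/imfsetP/mapP => -[].
    move=> j j_in ->; have := j_in : j \in iota 1 n.+1; rewrite mem_iota => jn.
    by exists j.-1; [rewrite mem_iota; lia | case: j jn {j_in}].
  move=> k; rewrite mem_iota => kn ->; exists k.+1 => //.
  by change (k.+1 \in iota 1 n.+1); rewrite mem_iota; lia.
have ptsP w : reflect (exists2 k, (k <= n)%N & w = omega d n a b k.+1) (w \in S).
  rewrite memS; apply: (iffP mapP) => -[k kn ->]; exists k => //.
    by move: kn; rewrite mem_iota.
  by rewrite mem_iota.
have S_pts : perm_eq S pts.
  apply: uniq_perm => //; rewrite map_inj_in_uniq ?iota_uniq // => k l.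
  rewrite !mem_iota /= !ltnS; exact: omega_inj.
split; first by rewrite (perm_size S_pts) size_map size_iota.
move=> sigma lambda sigmaE lambdaE.
have sgn k : (k <= n)%N -> sigma (omega d n a b k.+1) = (-1) ^+ k.
  by move=> kn; rewrite sigmaE // -signr_odd /=; case: (odd k).
have wgt k : (k <= n)%N -> lambda (omega d n a b k.+1)
    = if (k == 0)%N || (k == n) then 1 / 2 else 1.
  by move=> kn; rewrite lambdaE // !eqSS.
have [diagE v1 Omegav] := hOmega.
have Omega_pts k : (k <= n)%N -> Omega (omega d n a b k.+1).
  move=> kn; rewrite omega_node; have := node_itv (k%:R * pi / n%:R) hab.
  by have := congr1 (fun A => A (node a b (k%:R * pi / n%:R))) diagE;
    rewrite /diag /= in_itv /= => ->.
split.
- move=> w /ptsP[k kn ->]; split; first exact: Omega_pts.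
  by rewrite sgn // -signr_odd; case: (odd k); [right|left].
- split=> [w /ptsP[k kn ->]|f [Q sQ <-]].
    by rewrite wgt //; case: ifP => _; lra.
  rewrite (perm_big _ S_pts) big_map -/(index_iota 0 n.+1) big_mkord.
  rewrite -[RHS](@trapezoid_poly _ a b n (diag_poly Q)); last first.
    by rewrite (leq_trans (size_diag_poly _)) //; move: sQ; rewrite /Pi /= prednK.
  apply: eq_bigr => k _; have kn : (k <= n)%N by rewrite -ltnS.
  by rewrite wgt // sgn // polyfun_omega.
- move=> P Popt w /ptsP[k kn ->].
  set E := 2 * ((b - a) / 4) ^+ n.
  have E0 : 0 < E by rewrite mulr_gt0 // exprn_gt0 //; lra.
  have sup_le := supnorm_optimal_le hn hab hOmega Popt.
  have P_le l : (l <= n)%N ->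
      `|(diag_poly P).[node a b (l%:R * pi / n%:R)]| <= E.
    move=> ln; rewrite -polyfun_omega -lee_fin (le_trans _ sup_le) //.
    exact/le_supnorm/Omega_pts.
  have Pk : polyfun P (omega d n a b k.+1) = (-1) ^+ k * E.
    rewrite polyfun_omega monic_equioscillation //.
    exact: size_diag_poly_subXn Popt.1.
  have absPk : `|polyfun P (omega d n a b k.+1)| = E.
    by rewrite Pk normrMsign gtr0_norm.
  split; first exact: Omega_pts.
    apply/eqP; rewrite eq_le le_supnorm ?absPk //=; exact: Omega_pts.
  by rewrite sgn // Pk sgrM sgrX sgrN1 gtr0_sg ?mulr1.
Qed.
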